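(* Let $M,N\in\mathrm{pSh}(\Omega,L)$, $\bar a\in{}^{\mathrm{lh}(\bar a)}|M|$, $\bar b\in{}^{\mathrm{lh}(\bar a)}|N|$ with $E\bar b=E\bar a$, and let $\alpha$ be an ordinal. The following are equivalent: (1) $[\phi^\alpha_{M,\bar a}(\bar b)]_N=[\phi^\alpha_{N,\bar b}(\bar b)]_N$; (2) $F^\alpha_{M,\bar a}=F^\alpha_{N,\bar b}$.
   Context: **Presheaves.** Fix a complete Heyting algebra $\Omega$ (bottom $\bot$, top $\top$); $x\leftrightarrow y$ means $(x\to y)\wedge(y\to x)$. A presheaf $M$ over $\Omega$ is a set $|M|$ of sections with maps $E:|M|\to\Omega$ (extent) and $\upharpoonright:|M|\times\Omega\to|M|$ (restriction) such that $a\upharpoonright Ea=a$, $E(a\upharpoonright p)=Ea\wedge p$, $(a\upharpoonright p)\upharpoonright q=a\upharpoonright(p\wedge q)$. Put $[a=b]_M=\bigvee\{p\le Ea\wedge Eb: a\upharpoonright p=b\upharpoonright p\}$; presheaves are extensional: $Ea=Eb=[a=b]_M$ implies $a=b$. For a tuple $\bar a=\langle a_i:i<\gamma\rangle$ of sections, $\mathrm{lh}(\bar a)=\gamma$, $E\bar a=\bigwedge_iEa_i$ ($E\emptyset=\top$), $\bar a\upharpoonright p=\langle a_i\upharpoonright p\rangle_i$, $[\bar a=\bar b]_M=\bigwedge_i[a_i=b_i]_M$; $\bar a\bar c$ is the concatenation of $\bar a$ and $\bar c$. ${}^{\gamma}X$ (${}^{<\mu}X$) is the set of tuples from $X$ of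 length $\gamma$ (less than $\mu$). **Structures.** A signature has finitary relation symbols, finitary function symbols and a set of constant symbols, each constant symbol $c$ having extent $Ec=\top$. An element $M$ of $\mathrm{pSh}(\Omega,L)$ is a presheaf with: for each $n$-ary $R$ a map $R^M:|M|^n\to\Omega$ with $R^M(\bar a)\le E\bar a$ and $[\bar a=\bar b]_M\wedge R^M(\bar a)\le R^M(\bar b)$; for each $n$-ary $f$ a map $f^M:|M|^n\to|M|$ with $Ef^M(\bar a)=E\bar a$ and $[\bar a=\bar b]_M\le[f^M(\bar a)=f^M(\bar b)]_M$; for each constant $c$ a section $\mathfrak c^M$ with $E\mathfrak c^M=\top$. **Formulae.** $L$ is first order logic $\bar L_{\omega\omega}$ ($\lambda=\omega,\mu=2$), or $\bar L_{\infty\omega}$ ($\lambda=\omega,\mu=2$), or $L_{\infty\lambda}$ for a cardinal $\lambda$ ($\mu=\lambda$); variables are $v_i$, $i<\lambda$. Unnested atomic formulae are $v_i=v_j$, $v_i=c$, $R(v_{i_0},\dots,v_{i_{n-1}})$, $v_{i_n}=f(v_{i_0},\dots,v_{i_{n-1}})$. The formulae $\phi^\alpha$ used below are built from these by conjunction $\bigwedge$, existential quantification over fewer than $\mu$ variables, and unary connectives $\square_p$ ($p\in\Omega$). Interpretation: for unnested atomic $\psi$, $[\psi(\bar x)]_M$ is $E\bar x$ met with, respectively, $[x_i=x_j]_M$, $[x_i=\mathfrak c^M]_M$, $R^M(x_{i_0},\dots)$, $[x_{i_n}=f^M(x_{i_0},\dots)]_M$; $[\bigwedge\Phi(\bar a)]_M=E\bar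 a\wedge\bigwedge_{\psi\in\Phi}[\psi(\bar a)]_M$; $[\exists\bar u\,\psi(\bar a,\bar u)]_M=E\bar a\wedge\bigvee_{\bar c}[\psi(\bar a,\bar c)]_M$, $\bar c$ ranging over tuples from $|M|$ of the length of $\bar u$; $[\square_p\psi(\bar a)]_M=E\bar a\wedge(p\leftrightarrow[\psi(\bar a)]_M)$. **Functions $F^\alpha_{M,\bar a}$** (values in $\Omega$). $F^0_{M,\bar a}=I_{M,\bar a}$, where $I_{M,\bar a}$ has as domain all $(\psi,f)$ with $\psi$ an unnested atomic formula whose variables are exactly $v_0,\dots,v_{n-1}$ for some $n\in\omega$, and $f:\{0,\dots,n-1\}\to\mathrm{lh}(\bar a)$, and $I_{M,\bar a}(\psi,f)=[\psi(a_{f(0)},\dots,a_{f(n-1)})]_M$. At limits take unions. $F^{\alpha+1}_{M,\bar a}$ extends $F^\alpha_{M,\bar a}$ by new arguments $(F^\alpha_{K,\bar s\bar t},\alpha)$ where $K\in\mathrm{pSh}(\Omega,L)$, $\bar s\in{}^{\mathrm{lh}(\bar a)}|K|$, $\bar t\in{}^{<\mu}|K|$ and $E\bar t\le E\bar a\wedge E\bar s$, with value $\bigvee\{E\bar c:\bar c\in{}^{\mathrm{lh}(\bar t)}|M|,\ E\bar c\le E\bar t,\ F^\alpha_{K,(\bar s\bar t)\upharpoonright E\bar c}=F^\alpha_{M,\bar a\bar c}\}$. **Formulae $\phi^\alpha_{M,\bar a}$**, in free variables $\bar v$ with $\mathrm{lh}(\bar v)=\mathrm{lh}(\bar a)$: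 $\phi^0_{M,\bar a}=\bigwedge_\psi\square_{[\psi(\bar a)]_M}\psi(\bar v)$ over unnested atomic $\psi$; $\phi^\alpha_{M,\bar a}=\bigwedge_{\beta<\alpha}\phi^\beta_{M,\bar a}$ for limit $\alpha$; and $\phi^{\alpha+1}_{M,\bar a}=\phi^\alpha_{M,\bar a}\wedge\bigwedge_{K,\bar s\bar t}\square_{p_{K,\bar s\bar t}}\exists\bar u\,\phi^\alpha_{K,\bar s\bar t}(\bar v,\bar u)$, where $p_{K,\bar s\bar t}=[\exists\bar u\,\phi^\alpha_{K,\bar s\bar t}(\bar a,\bar u)]_M$, the conjunction is over $K\in\mathrm{pSh}(\Omega,L)$, $\bar s\in{}^{\mathrm{lh}(\bar a)}|K|$, $\bar t\in{}^{<\mu}|K|$, and $\bar u$ has length $\mathrm{lh}(\bar t)$.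
   Formalization: The value I_{M,a}(ψ,f) is met with the extent E a of the whole tuple, not only that of ⟨a_{f(0)},…,a_{f(n-1)}⟩; with the latter, the equivalence already fails at α=0 for a=⟨x,o⟩, b=⟨o,o⟩ with Ex=⊤, Eo=⊥. *)

(* Defs.v *)
From HB Require Import structures.
From mathcomp Require Import all_boot all_order.
From mathcomp Require Import boolp classical_sets cardinality.

Set Implicit Arguments.
Unset Strict Implicit.
Unset Printing Implicit Defensive.

Import Order.TTheory.
Local Open Scope order_scope.

HB.mixin Record TBLattice_isCompleteHeyting (d : Order.disp_t) T
    of Order.TBLattice d T := {
  Sup : set T -> T;
  Sup_supremums : forall A : set T, supremums A (Sup A);
  imp : T -> T -> T;
  impP : forall p q r : T, (Order.meet p q <= r) = (p <= imp q r)
}.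

#[short(type="cHeytingType")]
HB.structure Definition CompleteHeyting (d : Order.disp_t) :=
  { T of TBLattice_isCompleteHeyting d T & Order.TBLattice d T }.

Definition Inf (d : Order.disp_t) (Omega : cHeytingType d) (A : set Omega) :
  Omega := Sup (lbound A).

Definition biimp (d : Order.disp_t) (Omega : cHeytingType d) (p q : Omega) :
  Omega := Order.meet (imp p q) (imp q p).

(* An ordinal is an element of a well-ordered type [W]; the element [x] stands
   for the order type of [seg x], so the elements of [W] are the ordinals
   below the order type of [W]. *)

Record wellOrder := WellOrder {
  wo_disp : Order.disp_t;
  wo_sort :> orderType wo_disp;
  wo_wf : well_founded (fun x y : wo_sort => x < y)
}.

Definition seg (W : wellOrder) (x : W) : Type := {y : W | y < x}.

Definition is_zero (W : wellOrder) (x : W) : Prop := forall y : W, ~~ (y < x).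

Definition is_succ (W : wellOrder) (y x : W) : Prop :=
  y < x /\ forall z : W, z < x -> z <= y.

Definition infinite_cardinal (W : wellOrder) : Prop :=
  infinite_set [set: W] /\
  forall x : W, ~~ ([set: W] #<= [set y : W | (y < x)%O])%card.

Lemma wf_nat_lt : well_founded (fun x y : nat => (x < y)%O).
Proof.
move=> x; elim/ltn_ind: x => x IH; apply: Acc_intro => y.
by rewrite ltEnat; exact: IH.
Qed.

Lemma wf_I2_lt : well_founded (fun x y : 'I_2 => (x < y)%O).
Proof.
move=> x; elim/ltn_ind: {x}(nat_of_ord x) {-2}x (erefl (nat_of_ord x)) => n IH x xn.
apply: Acc_intro => y ltyx; apply: (IH (nat_of_ord y)) => //.
by rewrite -xn.
Qed.

Definition omega : wellOrder := WellOrder wf_nat_lt.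
Definition two : wellOrder := WellOrder wf_I2_lt.

Record signature := Signature {
  rsym : Type;
  fsym : Type;
  csym : Type;
  rar : rsym -> nat;
  far : fsym -> nat
}.

Variant logic :=
  | Lbar_omega_omega
  | Lbar_infty_omega
  | L_infty (lambda : wellOrder) of infinite_cardinal lambda.

Definition lam (L : logic) : wellOrder :=
  match L with
  | L_infty lambda _ => lambda
  | _ => omega
  end.

Definition mu (L : logic) : wellOrder :=
  match L with
  | L_infty lambda _ => lambda
  | _ => two
  end.

Record prePresheaf (d : Order.disp_t) (Omega : cHeytingType d) := PrePresheaf {
  sec :> Type;
  ext : sec -> Omega;
  res : sec -> Omega -> sec;
  res_ext : forall a : sec, res a (ext a) = a;
  ext_res : forall (a : sec) (p : Omega), ext (res a p) = Order.meet (ext a) p;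
  res_res : forall (a : sec) (p q : Omega),
    res (res a p) q = res a (Order.meet p q)
}.

Section Tuples.
Context (d : Order.disp_t) (Omega : cHeytingType d) (M : prePresheaf Omega).

Definition eqv (a b : M) : Omega :=
  Sup [set p | p <= Order.meet (ext a) (ext b) /\ res a p = res b p].

(* A tuple of length gamma is a map on the set of positions below gamma. *)
Definition ext_tuple (I : Type) (a : I -> M) : Omega :=
  Inf (range (fun i => ext (a i))).

Definition res_tuple (I : Type) (a : I -> M) (p : Omega) : I -> M :=
  fun i => res (a i) p.

Definition eqv_tuple (I : Type) (a b : I -> M) : Omega :=
  Inf (range (fun i => eqv (a i) (b i))).

End Tuples.

(* The positions of a tuple of length gamma + delta are the disjoint union of
   those of its two parts. *)
Definition concat (I J X : Type) (a : I -> X) (c : J -> X) : I + J -> X :=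
  fun k => match k with inl i => a i | inr j => c j end.

Record presheaf (d : Order.disp_t) (Omega : cHeytingType d) := Presheaf {
  presheaf_base :> prePresheaf Omega;
  presheaf_ext : forall a b : presheaf_base,
    ext a = ext b -> ext b = eqv a b -> a = b
}.

Record pSh (d : Order.disp_t) (Omega : cHeytingType d) (S : signature) := PSh {
  psh_sort :> presheaf Omega;
  rint : forall R : rsym S, ('I_(rar R) -> psh_sort) -> Omega;
  rint_ext : forall (R : rsym S) (a : 'I_(rar R) -> psh_sort),
    rint a <= ext_tuple a;
  rint_eqv : forall (R : rsym S) (a b : 'I_(rar R) -> psh_sort),
    Order.meet (eqv_tuple a b) (rint a) <= rint b;
  fint : forall f : fsym S, ('I_(far f) -> psh_sort) -> psh_sort;
  fint_ext : forall (f : fsym S) (a : 'I_(far f) -> psh_sort),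
    ext (fint a) = ext_tuple a;
  fint_eqv : forall (f : fsym S) (a b : 'I_(far f) -> psh_sort),
    eqv_tuple a b <= eqv (fint a) (fint b);
  cint : csym S -> psh_sort;
  cint_ext : forall c : csym S, ext (cint c) = Order.top
}.

(* Formulae are well scoped: [I] is the set of positions of the tuple of free
   variables, and quantifying over a tuple of variables of length [delta]
   passes from positions [I] to [I + seg delta].  That is, if the free variables
   are v_i for i < gamma, then the bound ones are v_(gamma + j) for j < delta. *)

Inductive atomic (S : signature) (I : Type) : Type :=
  | AEq (i j : I)
  | ACst (i : I) (c : csym S)
  | ARel (R : rsym S) (x : 'I_(rar R) -> I)
  | AFun (f : fsym S) (x : 'I_(far f) -> I) (y : I).

Definition avars (S : signature) (I : Type) (psi : atomic S I) : set I :=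
  match psi with
  | AEq i j => [set k | k = i \/ k = j]
  | ACst i _ => [set k | k = i]
  | ARel R x => [set k | exists m, k = x m]
  | AFun f x y => [set k | k = y \/ exists m, k = x m]
  end.

Definition arename (S : signature) (I J : Type) (h : I -> J)
    (psi : atomic S I) : atomic S J :=
  match psi with
  | AEq i j => AEq S (h i) (h j)
  | ACst i c => ACst (h i) c
  | ARel R x => ARel (fun m => h (x m))
  | AFun f x y => AFun (fun m => h (x m)) (h y)
  end.

Inductive formula (d : Order.disp_t) (Omega : cHeytingType d) (S : signature)
    (L : logic) (I : Type) : Type :=
  | Atom (psi : atomic S I)
  | And (X : Type) (phi : X -> formula Omega S L I)
  | Ex (delta : mu L) (phi : formula Omega S L (I + seg delta))
  | Box (p : Omega) (phi : formula Omega S L I).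

Definition And2 (d : Order.disp_t) (Omega : cHeytingType d) (S : signature)
    (L : logic) (I : Type) (phi psi : formula Omega S L I) :
  formula Omega S L I := And (fun x : bool => if x then phi else psi).

Definition ainterp (d : Order.disp_t) (Omega : cHeytingType d) (S : signature)
    (M : pSh Omega S) (I : Type) (psi : atomic S I) (a : I -> M) : Omega :=
  Order.meet (ext_tuple a)
    match psi with
    | AEq i j => eqv (a i) (a j)
    | ACst i c => eqv (a i) (cint M c)
    | ARel R x => rint (fun m => a (x m))
    | AFun f x y => eqv (a y) (fint (fun m => a (x m)))
    end.

Fixpoint interp (d : Order.disp_t) (Omega : cHeytingType d) (S : signature)
    (L : logic) (M : pSh Omega S) (I : Type) (phi : formula Omega S L I) :
    (I -> M) -> Omega :=
  match phi with
  | Atom psi => fun a => ainterp psi a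
  | And X phis => fun a =>
      Order.meet (ext_tuple a) (Inf (range (fun x => interp (phis x) a)))
  | Ex delta psi => fun a =>
      Order.meet (ext_tuple a)
        (Sup (range (fun c : seg delta -> M => interp psi (concat a c))))
  | Box p psi => fun a => Order.meet (ext_tuple a) (biimp p (interp psi a))
  end.

Section ScottAnalysis.
Context (d : Order.disp_t) (Omega : cHeytingType d) (S : signature) (L : logic).

Record extension (I : Type) := Extension {
  xK : pSh Omega S;
  xdelta : mu L;
  xs : I -> xK;
  xt : seg xdelta -> xK
}.

Definition phi_type : Type :=
  forall (M : pSh Omega S) (I : Type), (I -> M) -> formula Omega S L I.

Definition phi_zero : phi_type := fun M I a =>
  And (fun psi : atomic S I => Box (ainterp psi a) (Atom Omega L psi)).

Definition phi_succ (phi : phi_type) : phi_type := fun M I a =>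
  And2 (phi M I a)
    (And (fun x : extension I =>
       let chi := Ex (phi (xK x) _ (concat (@xs _ x) (@xt _ x))) in
       Box (interp chi a) chi)).

Definition phi_limit (X : Type) (phi : X -> phi_type) : phi_type :=
  fun M I a => And (fun x : X => phi x M I a).

Definition phi_step (W : wellOrder) (x : W)
    (phi : forall y : W, y < x -> phi_type) : phi_type :=
  match pselect (is_zero x) with
  | left _ => phi_zero
  | right _ =>
    match pselect (exists y, is_succ y x) with
    | left hx => let y := cid hx in phi_succ (phi (sval y) (proj1 (svalP y)))
    | right _ => phi_limit (fun y : seg x => phi (sval y) (svalP y))
    end
  end.

Definition phi (W : wellOrder) (alpha : W) : phi_type :=
  Fix (@wo_wf W) (fun _ => phi_type) (@phi_step W) alpha.

(* the domain of I_(M, a), for a tuple [a] with positions [I] *)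
Record atomic_arg (I : Type) := AtomicArg {
  arg_n : nat;
  arg_psi : atomic S 'I_arg_n;
  arg_vars : forall k : 'I_arg_n, avars arg_psi k;
  arg_f : 'I_arg_n -> I
}.

(* [psi(a_f(0), ..., a_f(n-1))] is read as the value at the whole tuple [a] of
   the formula psi(v_f(0), ..., v_f(n-1)) in the variables indexed by [I]. It is
   thus met with the extent of [a], not just of the a_f(i), as are the values
   in [phi_zero] and as the extents in the successor clause for F require. *)
Definition Iat (M : pSh Omega S) (I : Type) (a : I -> M) (x : atomic_arg I) :
  Omega := ainterp (arename (@arg_f _ x) (arg_psi x)) a.

(* Unfolding the recursion, F^x_(M, a) is I_(M, a) together with, for each
   y < x, the arguments (F^y_(K, st), y) added at stage y + 1. So a candidate
   value for F^x is a pair of a function on [atomic_arg I] and, for each y < x,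
   the graph of a partial function whose arguments are candidate values for
   F^y at tuples of the longer length. Equality in this type is equality of
   domains and of values. *)
Fixpoint Fty (W : wellOrder) (x : W) (hx : Acc (fun y z : W => y < z) x)
    (I : Type) {struct hx} : Type :=
  ((atomic_arg I -> Omega) *
   (forall (y : W) (hy : y < x) (delta : mu L),
      Fty (Acc_inv hx hy) (I + seg delta) -> Omega -> Prop))%type.

Fixpoint Facc (W : wellOrder) (x : W) (hx : Acc (fun y z : W => y < z) x)
    (M : pSh Omega S) (I : Type) (a : I -> M) {struct hx} : Fty hx I :=
  match hx as hx0 return Fty hx0 I with
  | Acc_intro hlt =>
    (Iat a,
     fun (y : W) (hy : y < x) (delta : mu L)
         (G : Fty (hlt y hy) (I + seg delta)) (v : Omega) =>
       exists (K : pSh Omega S) (s : I -> K) (t : seg delta -> K),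
         [/\ ext_tuple t <= Order.meet (ext_tuple a) (ext_tuple s),
             G = Facc (hlt y hy) (concat s t) &
             v = Sup [set p | exists c : seg delta -> M,
                   [/\ p = ext_tuple c,
                       ext_tuple c <= ext_tuple t &
                       Facc (hlt y hy) (res_tuple (concat s t) (ext_tuple c)) =
                       Facc (hlt y hy) (concat a c)]]])
  end.

Definition F (W : wellOrder) (alpha : W) (M : pSh Omega S) (I : Type)
  (a : I -> M) : Fty (wo_wf alpha) I := Facc (wo_wf alpha) a.

End ScottAnalysis.

Arguments phi {d Omega S} L {W} alpha {M I} a.
Arguments F {d Omega S} L {W} alpha {M I} a.

(* Main.v *)
(** Write sim_x(a, b) for the value of phi^x_(M, a) at b in N.  Each conjunct
    of phi^x says that some value at a and the corresponding value at b agree,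
    so sim_x is an Omega-valued equality of tuples: E a = sim_x(a, a), it is
    symmetric and transitive, and E a /\ p <= sim_x(a, a restricted to p).  By
    induction on x, if E a = E b then E b <= sim_x(a, b) iff F^x_a = F^x_b.
    Given this for y, the value of F^(y+1)_a at (F^y_st, y) is the join of the
    E c <= E t with E c <= sim_y(st, ac); when t is nonempty, restricting c to
    sim_y(st, ac) identifies it with the value of [exists u, phi^y_st(a, u)].
    This fails when t is empty, since its restrictions all have extent top; but
    then both kinds of values are determined by sim_y(s, a), and transitivity
    applies. *)

Require Import Defs.
From mathcomp Require Import all_boot all_order.
From mathcomp Require Import boolp classical_sets.

Set Implicit Arguments.
Unset Strict Implicit.
Unset Printing Implicit Defensive.

Import Order.TTheory.
Local Open Scope order_scope.

Arguments xt {d Omega S L I} e _.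

(** * Joins, meets and biimplication in a complete Heyting algebra *)

Section Heyting.
Context (d : Order.disp_t) (Omega : cHeytingType d).
Implicit Types (p q r : Omega) (A : set Omega).

Lemma le_Sup A p : A p -> p <= Sup A.
Proof. by move=> Ap; have [ub _] := Sup_supremums A; exact: ub. Qed.

Lemma Sup_le A p : (forall q, A q -> q <= p) -> Sup A <= p.
Proof. by move=> ubp; have [_ lub] := Sup_supremums A; exact: lub. Qed.

Lemma Inf_le A p : A p -> Inf A <= p.
Proof. by move=> Ap; apply: Sup_le => q; exact. Qed.

Lemma le_Inf A p : (forall q, A q -> p <= q) -> p <= Inf A.
Proof. by move=> lbp; exact: le_Sup. Qed.

Lemma le_Inf_range (X : Type) (f : X -> Omega) p :
  p <= Inf (range f) <-> forall x, p <= f x.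
Proof.
split=> [pf x|pf]; first by apply: (le_trans pf); apply: Inf_le; exists x.
by apply: le_Inf => _ [x _ <-].
Qed.

(** Turns a biimplication into an equation, so that similarity inherits symmetry and transitivity
    from equality. *)
Lemma le_biimp p q r :
  p <= biimp q r <-> Order.meet p q = Order.meet p r.
Proof.
rewrite /biimp lexI -!impP; split=> [/andP[pqr prq]|pqr].
  by apply/le_anti; rewrite !lexI !leIl pqr prq.
by rewrite pqr leIr -pqr leIr.
Qed.

End Heyting.

(** * Extents, restrictions and equality of tuples of sections *)

Section Tuples.
Context (d : Order.disp_t) (Omega : cHeytingType d) (M : prePresheaf Omega).
Implicit Types (a b : M) (p q : Omega).

Lemma le_ext_tuple (I : Type) (u : I -> M) p :
  p <= ext_tuple u <-> forall i, p <= ext (u i).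
Proof. exact: le_Inf_range. Qed.

Lemma ext_tuple_le (I : Type) (u : I -> M) i : ext_tuple u <= ext (u i).
Proof. by move: i; apply/le_ext_tuple. Qed.

Lemma le_eqv_tuple (I : Type) (u v : I -> M) p :
  p <= eqv_tuple u v <-> forall i, p <= eqv (u i) (v i).
Proof. exact: le_Inf_range. Qed.

Lemma ext_concat (I J : Type) (u : I -> M) (v : J -> M) :
  ext_tuple (concat u v) = Order.meet (ext_tuple u) (ext_tuple v).
Proof.
apply/le_anti; rewrite lexI -andbA; apply/and3P; split.
- by apply/le_ext_tuple => i; exact: (ext_tuple_le _ (inl i)).
- by apply/le_ext_tuple => j; exact: (ext_tuple_le _ (inr j)).
- apply/le_ext_tuple => -[i|j] /=.
    exact: le_trans (leIl _ _) (ext_tuple_le _ _).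
  exact: le_trans (leIr _ _) (ext_tuple_le _ _).
Qed.

Lemma res_concat (I J : Type) (u : I -> M) (v : J -> M) p :
  res_tuple (concat u v) p = concat (res_tuple u p) (res_tuple v p).
Proof. by apply/funext => -[]. Qed.

Lemma res_tuple_res (I : Type) (u : I -> M) p q :
  res_tuple (res_tuple u p) q = res_tuple u (Order.meet p q).
Proof. by apply/funext => i; exact: res_res. Qed.

Lemma ext_tuple_empty (I : Type) (u : I -> M) :
  (I -> False) -> ext_tuple u = \top.
Proof. by move=> I0; apply/eqP; rewrite -le1x; apply/le_ext_tuple => i. Qed.

(** The form of the restriction law that covers empty tuples too. *)
Lemma meet_ext_res (I : Type) (u : I -> M) p :
  Order.meet p (ext_tuple (res_tuple u p)) = Order.meet p (ext_tuple u).
Proof.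
apply/le_anti; rewrite !lexI !leIl /=; apply/andP; split.
  apply/le_ext_tuple => i; apply: le_trans (leIr _ _) _.
  by apply: le_trans (ext_tuple_le _ i) _; rewrite ext_res leIl.
apply/le_ext_tuple => i; rewrite ext_res lexI leIl andbT.
exact: le_trans (leIr _ _) (ext_tuple_le _ _).
Qed.

(* Fails for an empty tuple, which every restriction leaves with extent top. *)
Lemma ext_tuple_res (I : Type) (i : I) (u : I -> M) p :
  ext_tuple (res_tuple u p) = Order.meet (ext_tuple u) p.
Proof.
rewrite meetC -meet_ext_res; apply/esym/meet_idPr.
by apply: le_trans (ext_tuple_le _ i) _; rewrite ext_res leIr.
Qed.

Lemma le_eqv a b p :
  p <= ext a -> p <= ext b -> res a p = res b p -> p <= eqv a b.
Proof. by move=> pa pb ab; apply: le_Sup; split; rewrite ?lexI ?pa. Qed.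

Lemma eqv_le a b : eqv a b <= Order.meet (ext a) (ext b).
Proof. by apply: Sup_le => p []. Qed.

Lemma eqvxx a : eqv a a = ext a.
Proof.
apply/le_anti; rewrite le_eqv //.
by rewrite (le_trans (eqv_le a a)) ?leIl.
Qed.

Lemma eqv_sym a b : eqv a b = eqv b a.
Proof. by congr Sup; apply/seteqP; split=> p [? ?]; rewrite meetC. Qed.

Lemma eqv_trans b a c p : p <= eqv a b -> p <= eqv b c -> p <= eqv a c.
Proof.
move=> pab pbc; have: p <= Order.meet (eqv a b) (eqv b c) by rewrite lexI pab.
move=> /le_trans; apply; rewrite impP; apply: Sup_le => q [qab abq].
rewrite -impP meetC impP; apply: Sup_le => r [rbc bcr]; rewrite -impP.
move: qab rbc; rewrite !lexI => /andP[qa _] /andP[_ rc].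
apply: le_eqv; first exact: le_trans (leIr _ _) qa.
  exact: le_trans (leIl _ _) rc.
by rewrite [Order.meet r q]meetC -res_res abq res_res meetC -res_res bcr res_res.
Qed.

Lemma le_eqv_res a p : Order.meet (ext a) p <= eqv a (res a p).
Proof.
apply: le_eqv; rewrite ?ext_res ?leIl // res_res; congr res.
by apply/esym/meet_idPr; rewrite leIr.
Qed.

End Tuples.

(** * Values of unnested atomic formulae *)

Section Structures.
Context (d : Order.disp_t) (Omega : cHeytingType d) (S : signature).
Implicit Types (K M N : pSh Omega S) (p q : Omega).

Lemma ainterp_le_ext M (I : Type) (psi : atomic S I) (a : I -> M) :
  ainterp psi a <= ext_tuple a.
Proof. exact: leIl. Qed.

Lemma ainterp_eqv M (I : Type) (psi : atomic S I) (a b : I -> M) p :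
  p <= eqv_tuple a b -> p <= ainterp psi a -> p <= ainterp psi b.
Proof.
move=> /le_eqv_tuple pab; rewrite /ainterp !lexI => /andP[_ pa].
have pba i : p <= eqv (b i) (a i) by rewrite eqv_sym.
apply/andP; split.
  apply/le_ext_tuple => i; apply: (le_trans (pab i)).
  by apply: (le_trans (eqv_le _ _)); rewrite leIr.
case: psi pa => [i j|i c|R u|f u y] pa.
- exact: eqv_trans (pba i) (eqv_trans pa (pab j)).
- exact: eqv_trans (pba i) pa.
- apply: le_trans _ (rint_eqv (fun m => a (u m)) _); rewrite lexI pa andbT.
  by apply/le_eqv_tuple => m.
- apply: eqv_trans (pba y) (eqv_trans pa _); apply: le_trans _ (fint_eqv _ _).
  by apply/le_eqv_tuple => m.
Qed.

Lemma ainterp_res M (I : Type) (psi : atomic S I) (a : I -> M) p :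
  Order.meet (ext_tuple a) p <=
    biimp (ainterp psi a) (ainterp psi (res_tuple a p)).
Proof.
have Hq i : Order.meet (ext_tuple a) p <= eqv (a i) (res_tuple a p i).
  by apply: le_trans (le_eqv_res _ _); apply: leI2 (ext_tuple_le _ _) (le_refl _).
have H1 : Order.meet (ext_tuple a) p <= eqv_tuple a (res_tuple a p).
  exact/le_eqv_tuple.
have H2 : Order.meet (ext_tuple a) p <= eqv_tuple (res_tuple a p) a.
  by apply/le_eqv_tuple => i; rewrite eqv_sym.
rewrite /biimp lexI -!impP; apply/andP; split.
  by apply: ainterp_eqv (leIr _ _); apply: le_trans H1; rewrite leIl.
by apply: ainterp_eqv (leIr _ _); apply: le_trans H2; rewrite leIl.
Qed.

Lemma ext_tuple_comp M (I J : Type) (h : J -> I) (g : I -> J) (a : I -> M) :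
  cancel g h -> ext_tuple (a \o h) = ext_tuple a.
Proof.
move=> gK; apply/le_anti/andP; split; apply/le_ext_tuple => i.
  by rewrite -[i]gK; exact: (ext_tuple_le (a \o h)).
exact: ext_tuple_le.
Qed.

Lemma ainterp_arename M (I J : Type) (h : J -> I) (psi : atomic S J)
    (a : I -> M) :
  ainterp (arename h psi) a =
  Order.meet (ext_tuple a) (ainterp psi (a \o h)).
Proof.
have H : ext_tuple a <= ext_tuple (a \o h).
  by apply/le_ext_tuple => j; exact: ext_tuple_le.
by rewrite /ainterp meetA (meet_idPl H); case: psi.
Qed.

(** Each slot of [psi] gets a variable of its own, and [arg_f] may send several of them to one
    position. Hence [Iat] records all atomic values, although its formulae use exactly the first n
    variables. *)
Lemma atomic_argP (I : Type) (psi : atomic S I) :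
  exists x : atomic_arg S I, arename (@arg_f _ _ x) (arg_psi x) = psi.
Proof.
case: psi => [i j|i c|R u|f u y].
- have hv : forall k, avars (@AEq S 'I_2 ord0 ord_max) k.
    move=> k; case: (unliftP ord0 k) => [k' ->|->]; last by left.
    by right; apply: val_inj; rewrite /= (ord1 k').
  by exists (AtomicArg hv (fun k => if k == ord0 then i else j)).
- have hv : forall k, avars (@ACst S 'I_1 ord0 c) k by move=> k; rewrite /= (ord1 k).
  by exists (AtomicArg hv (fun=> i)).
- have hv : forall k, avars (@ARel S _ R id) k by move=> k; exists k.
  by exists (AtomicArg hv u).
- have hv : forall k, avars (@AFun S 'I_(far f).+1 f (lift ord0) ord0) k.
    by move=> k; case: (unliftP ord0 k) => [k' ->|->]; [right; exists k'|left].
  exists (AtomicArg hv (fun k => if unlift ord0 k is Some m then u m else y)).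
  rewrite /= unlift_none; congr (AFun _ _); apply/funext => m.
  by rewrite liftK.
Qed.

Lemma eq_Iat M N (I : Type) (a : I -> M) (b : I -> N) :
  Iat a = Iat b <-> forall psi : atomic S I, ainterp psi a = ainterp psi b.
Proof.
split=> [H psi|H]; last by apply/funext => x; exact: H.
by have [x <-] := atomic_argP psi; have := congr1 (@^~ x) H.
Qed.

Lemma ainterp_AEq M (I : Type) (i : I) (a : I -> M) :
  ainterp (AEq S i i) a = ext_tuple a.
Proof. by rewrite /ainterp eqvxx; apply/meet_idPl; exact: ext_tuple_le. Qed.

(** The formula v_i = v_i reads off the extent, and an empty tuple has extent top. *)
Lemma eq_Iat_ext M N (I : Type) (a : I -> M) (b : I -> N) :
  Iat a = Iat b -> ext_tuple a = ext_tuple b.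
Proof.
move=> /eq_Iat ab; have [[i]|I0] := pselect (inhabited I).
  by rewrite -(ainterp_AEq i) ab ainterp_AEq.
have {}I0 : I -> False by move=> i; exact: I0 (inhabits i).
by rewrite !ext_tuple_empty.
Qed.

End Structures.

(** * The Omega-valued similarity given by the formulae phi *)

Section Similarity.
Context (d : Order.disp_t) (Omega : cHeytingType d) (S : signature) (L : logic).
Context (W : wellOrder).
Implicit Types (K M N : pSh Omega S) (p q : Omega) (x y z : W).

Definition sim x M N (I : Type) (a : I -> M) (b : I -> N) : Omega :=
  interp (phi L x a) b.

(** For [u] consisting of K, s and t, this is the truth value p_(K, st) that labels a box in
    phi^(y+1). *)
Definition ext_val y (I : Type) (u : extension Omega S L I) M (a : I -> M) :
    Omega :=
  interp (Ex (phi L y (concat (xs u) (xt u)))) a.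

Lemma phiE x :
  @phi d Omega S L W x = phi_step (fun y (_ : y < x) => @phi d Omega S L W y).
Proof.
rewrite /phi Fix_eq // => z f g fg; congr phi_step.
apply/functional_extensionality_dep => y.
by apply/functional_extensionality_dep => hy; exact: fg.
Qed.

(** Puts zero, successor and limit stages into one form: phi^x compares the atomic values and the
    values [ext_val] of every earlier stage. *)
Lemma simP x M N (I : Type) (a : I -> M) (b : I -> N) p :
  p <= sim x a b <->
  [/\ p <= ext_tuple b,
      forall psi : atomic S I, p <= biimp (ainterp psi a) (ainterp psi b) &
      forall y (u : extension Omega S L I), y < x ->
        p <= biimp (ext_val y u a) (ext_val y u b)].
Proof.
elim/(well_founded_ind (@wo_wf W)): x p => x IH p.
rewrite /sim phiE /phi_step; case: pselect => [x0|xn0].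
  rewrite /= lexI; split.
    move=> /andP[pb /le_Inf_range H]; split=> // [psi|y u yx].
      by have := H psi; rewrite lexI => /andP[].
    by have := x0 y; rewrite yx.
  case=> pb H _; rewrite pb; apply/le_Inf_range => psi.
  by rewrite lexI pb; exact: H.
case: pselect => [hy|nsucc].
  case: (cid hy) => y /= [yx ymax]; rewrite lexI; split.
    (* The conjunct phi^y covers the atomic values and the stages below [y]; the other conjunct
       covers [y] itself. *)
    move=> /andP[pb /le_Inf_range H]; have /IH := H true => /(_ yx) [_ Hpsi Hu].
    split=> // z u zx; have := ymax z zx.
    rewrite le_eqVlt => /orP[/eqP ->|]; last exact: Hu.
    have := H false; rewrite /= lexI => /andP[_ /le_Inf_range /(_ u)].
    by rewrite lexI => /andP[].
  case=> pb Hpsi Hu; rewrite pb; apply/le_Inf_range => -[].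
    by apply/IH => //; split=> // z u zy; apply: Hu; exact: lt_trans yx.
  rewrite /= lexI pb; apply/le_Inf_range => u; rewrite lexI pb.
  exact: Hu.
rewrite /= lexI; split.
  move=> /andP[pb /le_Inf_range H]; split=> // [psi|y u yx].
    have [y yx] : exists y, y < x.
      apply: contrapT => H0; apply: xn0 => y; apply/negP => yx.
      by apply: H0; exists y.
    by have := H (exist _ y yx) => /= /(IH _ yx)[].
  (* As [x] is not a successor, some [z] lies strictly between [y] and [x], and phi^z compares the
     values of stage [y]. *)
  have [z zx yz] : exists2 z, z < x & y < z.
    apply: contrapT => H0; apply: nsucc; exists y; split=> // z zx.
    by rewrite leNgt; apply/negP => yz; apply: H0; exists z.
  by have := H (exist _ z zx) => /= /(IH _ zx)[_ _]; apply.
case=> pb Hpsi Hu; rewrite pb; apply/le_Inf_range => -[y yx] /=.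
by apply/(IH _ yx); split=> // z u zy; apply: Hu; exact: lt_trans yx.
Qed.

(** The bound by [ext_tuple a] comes from the formulae v_i = v_i, whose values at [a] and at [b] are
    the two extents. *)
Lemma sim_le_ext x M N (I : Type) (a : I -> M) (b : I -> N) :
  sim x a b <= Order.meet (ext_tuple a) (ext_tuple b).
Proof.
have /simP[pb H _] := le_refl (sim x a b); rewrite lexI pb andbT.
apply/le_ext_tuple => i; apply: le_trans (ext_tuple_le a i).
have /le_biimp := H (AEq S i i); rewrite !ainterp_AEq (meet_idPl pb) => <-.
exact: leIr.
Qed.

Lemma sim_concat_le_ext x M N (I J : Type) (s : I -> M) (t : J -> M)
    (a : I -> N) (c : J -> N) (p := sim x (concat s t) (concat a c)) :
  [/\ p <= ext_tuple s, p <= ext_tuple t, p <= ext_tuple a & p <= ext_tuple c].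
Proof.
have := sim_le_ext x (concat s t) (concat a c); rewrite !ext_concat !lexI.
by move=> /andP[/andP[-> ->] /andP[-> ->]].
Qed.

Lemma simxx x M (I : Type) (a : I -> M) : sim x a a = ext_tuple a.
Proof.
apply/le_anti; rewrite (le_trans (sim_le_ext x a a)) ?leIl //=.
by apply/simP; split=> // *; apply/le_biimp.
Qed.

Lemma sim_sym x M N (I : Type) (a : I -> M) (b : I -> N) :
  sim x a b = sim x b a.
Proof.
suff H M' N' (a' : I -> M') (b' : I -> N') : sim x a' b' <= sim x b' a'.
  by apply/le_anti; rewrite !H.
rewrite {M N a b}; move: M' N' a' b' => M N a b.
have /simP[_ H1 H2] := le_refl (sim x a b); apply/simP; split.
- by rewrite (le_trans (sim_le_ext x a b)) ?leIl.
- by move=> psi; apply/le_biimp/esym/le_biimp.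
- by move=> y u yx; apply/le_biimp/esym/le_biimp; exact: H2.
Qed.

Lemma sim_trans x K M N (I : Type) (b : I -> M) (a : I -> K) (c : I -> N) p :
  p <= sim x a b -> p <= sim x b c -> p <= sim x a c.
Proof.
move=> /simP[_ ab1 ab2] /simP[pc bc1 bc2]; apply/simP; split=> //.
  move=> psi; apply/le_biimp.
  by move/le_biimp: (ab1 psi) => ->; apply/le_biimp.
move=> y u yx; apply/le_biimp.
by move/le_biimp: (ab2 y u yx) => ->; apply/le_biimp; exact: bc2.
Qed.

Lemma sim_le_ext_val y (I : Type) (u : extension Omega S L I) M (a : I -> M)
    (c : seg (xdelta u) -> M) :
  sim y (concat (xs u) (xt u)) (concat a c) <= ext_val y u a.
Proof.
rewrite /ext_val /= lexI; apply/andP; split; last by apply: le_Sup; exists c.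
by apply: le_trans (sim_le_ext _ _ _) _; rewrite !ext_concat leIxr ?leIl.
Qed.

Lemma ext_val_le y (I : Type) (u : extension Omega S L I) M (a : I -> M) p :
  (forall c : seg (xdelta u) -> M,
     sim y (concat (xs u) (xt u)) (concat a c) <= p) ->
  ext_val y u a <= p.
Proof.
by move=> H; rewrite /ext_val /= leIxr //; apply: Sup_le => _ [c _ <-]; exact: H.
Qed.

Lemma meet_ext_val_le y (I : Type) (u : extension Omega S L I) M (a : I -> M)
    q p :
  (forall c : seg (xdelta u) -> M,
     Order.meet q (sim y (concat (xs u) (xt u)) (concat a c)) <= p) ->
  Order.meet q (ext_val y u a) <= p.
Proof.
move=> H; rewrite meetC impP; apply: ext_val_le => c; rewrite -impP meetC.
exact: H.
Qed.

(** By induction on [x]. Up to the left-hand side, a witness [c] for [a] yields its restriction to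
    [p] as a witness for the restricted tuple, and a witness for the restricted tuple serves for [a]
    unchanged. *)
Lemma sim_res x M (I : Type) (a : I -> M) p :
  Order.meet (ext_tuple a) p <= sim x a (res_tuple a p).
Proof.
elim/(well_founded_ind (@wo_wf W)): x I a => x IH I a; apply/simP; split.
- by rewrite [leLHS]meetC -meet_ext_res leIr.
- by move=> psi; exact: ainterp_res.
move=> y u yx; have IHac c : Order.meet (ext_tuple (concat a c)) p <=
    sim y (concat a c) (concat (res_tuple a p) (res_tuple c p)).
  by rewrite -res_concat; exact: IH.
have IHapc c : Order.meet (ext_tuple (concat (res_tuple a p) c)) p <=
    sim y (concat (res_tuple a p) c) (concat (res_tuple a p) (res_tuple c p)).
  have -> : concat (res_tuple a p) (res_tuple c p) =
      res_tuple (concat (res_tuple a p) c) p.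
    by rewrite res_concat res_tuple_res meetxx.
  exact: IH.
rewrite lexI -!impP; apply/andP; split; apply: meet_ext_val_le => c.
  apply: (le_trans _ (sim_le_ext_val _ _ (res_tuple c p))).
  apply: (sim_trans (b := concat a c)); first exact: leIr.
  apply: le_trans (IHac _ c); rewrite lexI; apply/andP; split.
    by rewrite (le_trans (leIr _ _)) // (le_trans (sim_le_ext _ _ _)) ?leIr.
  by rewrite (le_trans (leIl _ _)) ?leIr.
apply: (le_trans _ (sim_le_ext_val _ _ c)).
have pl : forall q, Order.meet (Order.meet (ext_tuple a) p) q <= p.
  by move=> q; rewrite (le_trans (leIl _ _)) ?leIr.
set q := sim _ _ _.
have qc : Order.meet (Order.meet (ext_tuple a) p) q <=
    ext_tuple (concat (res_tuple a p) c).
  by rewrite (le_trans (leIr _ _)) // (le_trans (sim_le_ext _ _ _)) ?leIr.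
(* The link between [concat (res_tuple a p) c] and [concat a c] is their common restriction to
   [p]. *)
apply: (sim_trans (b := concat (res_tuple a p) c)); first exact: leIr.
apply: (sim_trans (b := concat (res_tuple a p) (res_tuple c p))).
  by apply: le_trans (IHapc _ c); rewrite lexI pl andbT.
rewrite sim_sym; apply: le_trans (IHac _ c); rewrite lexI pl andbT.
rewrite ext_concat lexI -{1}meetA leIl /=.
by move: qc; rewrite ext_concat lexI => /andP[].
Qed.

(** Appending an empty tuple changes the type of positions, so invariance under bijective renaming
    is proved by induction on [x]: new positions stay fixed, and the part [xs u] of an extension is
    pulled back along [g]. *)
Lemma sim_comp_le x M N (I J : Type) (h : J -> I) (g : I -> J)
    (a : I -> M) (b : I -> N) :
  cancel h g -> cancel g h -> sim x a b <= sim x (a \o h) (b \o h).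
Proof.
elim/(well_founded_ind (@wo_wf W)): x M N I J h g a b => x IH.
move=> M N I J h g a b hK gK.
have IHE y K K' (s : I -> K) (s' : I -> K') (X : Type)
      (t : X -> K) (t' : X -> K') : y < x ->
    sim y (concat s t) (concat s' t') =
    sim y (concat (s \o h) t) (concat (s' \o h) t').
  move=> yx.
  pose H (k : J + X) : I + X :=
    match k with inl i => inl (h i) | inr k => inr k end.
  pose G (k : I + X) : J + X :=
    match k with inl i => inl (g i) | inr k => inr k end.
  have HK : cancel H G by case=> //= i; rewrite hK.
  have GK : cancel G H by case=> //= i; rewrite gK.
  have E (Z : Type) (v : I -> Z) (w : X -> Z) :
      concat v w \o H = concat (v \o h) w.
    by apply/funext => -[].
  have E' (Z : Type) (v : I -> Z) (w : X -> Z) :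
      concat (v \o h) w \o G = concat v w.
    by apply/funext => -[i|k] //=; rewrite gK.
  apply/le_anti; apply/andP; split.
    by rewrite -!E; exact: IH yx _ _ _ _ _ _ _ _ HK GK.
  rewrite -[concat s t]E' -[concat s' t']E'.
  exact: IH yx _ _ _ _ _ _ _ _ GK HK.
have ev y K (u : extension Omega S L J) (s : I -> K) : y < x ->
   ext_val y u (s \o h) = ext_val y (Extension (xs u \o g) (xt u)) s.
  move=> yx; rewrite /ext_val /= (ext_tuple_comp _ gK).
  congr (Order.meet _ (Sup _)).
  apply: eq_imagel => c _; rewrite -!/(sim _ _ _) [RHS]IHE //; congr sim.
  by apply/funext => -[i|k] //=; rewrite hK.
have /simP[H1 H2 H3] := le_refl (sim x a b); apply/simP; split.
- by rewrite (ext_tuple_comp _ gK).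
- move=> psi; have := H2 (arename h psi); rewrite !ainterp_arename.
  by rewrite -!(ext_tuple_comp _ gK) !(meet_idPr (ainterp_le_ext _ _)).
- by move=> y u yx; rewrite !ev //; exact: H3.
Qed.

(** * The functions F and their values at added arguments *)

Definition Fval y M (I : Type) (a : I -> M) K (delta : mu L) (s : I -> K)
    (t : seg delta -> K) : Omega :=
  Sup [set p | exists c : seg delta -> M,
    [/\ p = ext_tuple c, ext_tuple c <= ext_tuple t &
        F L y (res_tuple (concat s t) (ext_tuple c)) = F L y (concat a c)]].

(** The arguments that F^(y+1) adds to F^y, with their values. One [G] can come from many pairs [s],
    [t]; [Fval_eq] shows that for given [a] the value depends on [G] alone. *)
Definition Fgraph y M (I : Type) (a : I -> M) (delta : mu L)
    (G : Fty Omega S L (wo_wf y) (I + seg delta)) (v : Omega) : Prop :=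
  exists (K : pSh Omega S) (s : I -> K) (t : seg delta -> K),
    [/\ ext_tuple t <= Order.meet (ext_tuple a) (ext_tuple s),
        G = F L y (concat s t) & v = Fval y a s t].

Lemma F_eqP x M N (I : Type) (a : I -> M) (b : I -> N) :
  F L x a = F L x b <->
  Iat a = Iat b /\
  forall y delta, y < x -> @Fgraph y M I a delta = @Fgraph y N I b delta.
Proof.
rewrite /Fgraph /Fval /F; case: (wo_wf x) => hlt /=.
(* Accessibility proofs are unique, so the earlier stages inside [F] are again given by [F]. *)
have -> : hlt = fun y _ => wo_wf y.
  apply/functional_extensionality_dep => y.
  by apply/functional_extensionality_dep => hy; exact: Prop_irrelevance.
split=> [[-> H]|[-> H]].
  split=> // y delta yx.
  have := congr1 (fun f => f y yx delta) H.
  exact.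
congr pair; apply/functional_extensionality_dep => y.
apply/functional_extensionality_dep => yx.
by apply/functional_extensionality_dep => delta; exact: H.
Qed.

Lemma le_F y x M N (I : Type) (a : I -> M) (b : I -> N) :
  y <= x -> F L x a = F L x b -> F L y a = F L y b.
Proof.
move=> yx /F_eqP[H0 H]; apply/F_eqP; split=> // z delta zy.
by apply: H; exact: lt_le_trans yx.
Qed.

Lemma F_eq_ext x M N (I : Type) (a : I -> M) (b : I -> N) :
  F L x a = F L x b -> ext_tuple a = ext_tuple b.
Proof. by move=> /F_eqP[/eq_Iat_ext]. Qed.

(** An empty [u] forces [c] to be empty, and then both extents are top. *)
Lemma ext_tuple_res_ext M K (I J : Type) (c : J -> M) (u : I + J -> K) :
  ext_tuple c <= ext_tuple u ->
  ext_tuple (res_tuple u (ext_tuple c)) = ext_tuple c.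
Proof.
move=> cu; have [[k]|k0] := pselect (inhabited (I + J)).
  by rewrite (ext_tuple_res k); apply/meet_idPr.
have {}k0 : I + J -> False by move=> k; exact: k0 (inhabits k).
by rewrite !ext_tuple_empty // => j; exact: k0 (inr j).
Qed.

Definition sim_decides_F y := forall M N (I : Type) (a : I -> M) (b : I -> N),
  ext_tuple a = ext_tuple b ->
  (ext_tuple b <= sim y a b <-> F L y a = F L y b).

(** The two tuples compared by F^y both have extent [ext_tuple c], so the hypothesis on [y] applies,
    and [sim_res] removes the restriction from [concat s t]. *)
Lemma FvalE y M K (I : Type) (delta : mu L) (a : I -> M) (s : I -> K)
    (t : seg delta -> K) :
  sim_decides_F y -> ext_tuple t <= Order.meet (ext_tuple a) (ext_tuple s) ->
  Fval y a s t = Sup [set p | exists c : seg delta -> M,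
    [/\ p = ext_tuple c, p <= ext_tuple t &
        p <= sim y (concat s t) (concat a c)]].
Proof.
move=> simF; rewrite lexI => /andP[ta ts].
have FP (c : seg delta -> M) : ext_tuple c <= ext_tuple t ->
    F L y (res_tuple (concat s t) (ext_tuple c)) = F L y (concat a c) <->
    ext_tuple c <= sim y (concat s t) (concat a c).
  move=> ct; have cst : ext_tuple c <= ext_tuple (concat s t).
    by rewrite ext_concat lexI ct (le_trans ct).
  have cac : ext_tuple (concat a c) = ext_tuple c.
    by rewrite ext_concat; apply/meet_idPr; exact: le_trans ta.
  have stc := sim_res y (concat s t) (ext_tuple c).
  rewrite (meet_idPr cst) in stc.
  apply: iff_trans (iff_sym (simF _ _ _ _ _ _)) _.
    by rewrite cac ext_tuple_res_ext.
  rewrite cac; split; first exact: sim_trans.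
  by apply: sim_trans; rewrite sim_sym.
congr Sup; apply/seteqP; split=> p [c [-> ct H]]; exists c; split=> //;
  exact/(FP c ct).
Qed.

(** Equality of F^y makes the two extensions similar up to their common extent, so by transitivity
    the same [c] contribute to both joins. *)
Lemma Fval_eq y M K K' (I : Type) (delta : mu L) (a : I -> M)
    (s : I -> K) (t : seg delta -> K) (s' : I -> K') (t' : seg delta -> K') :
  sim_decides_F y ->
  ext_tuple t <= Order.meet (ext_tuple a) (ext_tuple s) ->
  ext_tuple t' <= Order.meet (ext_tuple a) (ext_tuple s') ->
  F L y (concat s t) = F L y (concat s' t') ->
  Fval y a s t = Fval y a s' t'.
Proof.
move=> simF ts ts' FE; rewrite !FvalE //.
have Et : ext_tuple (concat s t) = ext_tuple t.
  by rewrite ext_concat; apply/meet_idPr; rewrite (le_trans ts) ?leIr.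
have Et' : ext_tuple (concat s' t') = ext_tuple t'.
  by rewrite ext_concat; apply/meet_idPr; rewrite (le_trans ts') ?leIr.
have EE := F_eq_ext FE; have /simF := EE; rewrite FE => -[_ /(_ erefl)].
move: EE; rewrite Et Et' => EE st'.
congr Sup; apply/seteqP; split=> p [c [pc pt H]]; exists c; split=> //.
- by rewrite -EE.
- by apply: sim_trans H; rewrite sim_sym; apply: le_trans st'; rewrite -EE.
- by rewrite EE.
- by apply: sim_trans H; apply: le_trans st'.
Qed.

(** The position [j] makes [c] nonempty, so its restriction to [q] has extent exactly [q], and the
    join in [FvalE] reaches every value of [sim]. *)
Lemma Fval_ext_val y M K (I : Type) (delta : mu L) (j : seg delta)
    (a : I -> M) (s : I -> K) (t : seg delta -> K) :
  sim_decides_F y ->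
  ext_tuple t <= Order.meet (ext_tuple a) (ext_tuple s) ->
  Fval y a s t = ext_val y (Extension s t) a.
Proof.
move=> simF ts; rewrite FvalE //; apply/le_anti/andP; split.
  apply: Sup_le => p [c [_ _ H]]; apply: le_trans H _.
  exact: (@sim_le_ext_val _ _ (Extension s t)).
apply: ext_val_le => /= c; set q := sim _ _ _.
have [_ qt qa qc] := sim_concat_le_ext y s t a c; rewrite -/q in qt qa qc.
have cq : ext_tuple (res_tuple c q) = q.
  by rewrite (ext_tuple_res j); apply/meet_idPr.
apply: le_Sup; exists (res_tuple c q); split=> //.
apply: (sim_trans (b := concat a c)); first exact: le_refl.
apply: (sim_trans (b := res_tuple (concat a c) q)).
  by apply: le_trans (sim_res _ _ _); rewrite ext_concat !lexI qa qc /=.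
have -> : res_tuple (concat a c) q = res_tuple (concat a (res_tuple c q)) q.
  by rewrite !res_concat res_tuple_res meetxx.
rewrite sim_sym; apply: le_trans (sim_res _ _ _).
by rewrite ext_concat cq !lexI qa /= le_refl.
Qed.

(* F only admits extensions with E t <= E a /\ E s, while phi admits all of
   them; cutting t down to this bound does not change the value. *)
Lemma ext_val_res y M (I : Type) (u : extension Omega S L I) (a : I -> M) :
  let q := Order.meet (ext_tuple a) (ext_tuple (xs u)) in
  ext_val y u a = ext_val y (Extension (xs u) (res_tuple (xt u) q)) a.
Proof.
move=> q; set u' := Extension _ _.
have tq r : r <= q -> (r <= ext_tuple (xt u')) = (r <= ext_tuple (xt u)).
  have := congr1 (<=%O r) (meet_ext_res (xt u) q).
  by rewrite [in LHS]lexI [in RHS]lexI => E rq; rewrite rq in E.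
have uu' r : r <= q -> r <= ext_tuple (xt u) ->
    r <= sim y (concat (xs u) (xt u)) (concat (xs u') (xt u')).
  move=> rq rt; have rs : r <= ext_tuple (xs u) by rewrite (le_trans rq) ?leIr.
  apply: (sim_trans (b := res_tuple (concat (xs u) (xt u)) q)).
    by apply: le_trans (sim_res _ _ _); rewrite lexI rq ext_concat lexI rs rt.
  have -> : res_tuple (concat (xs u) (xt u)) q =
      res_tuple (concat (xs u') (xt u')) q.
    by rewrite !res_concat res_tuple_res meetxx.
  rewrite sim_sym; apply: le_trans (sim_res _ _ _).
  by rewrite lexI rq ext_concat lexI rs tq // rt.
apply/le_anti/andP; split; apply: ext_val_le => c.
  have [ps pt pa _] := sim_concat_le_ext y (xs u) (xt u) a c.
  apply: (le_trans _ (@sim_le_ext_val y I u' M a c)).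
  apply: (sim_trans (b := concat (xs u) (xt u))) => //.
  by rewrite [leRHS]sim_sym; apply: uu' => //; rewrite lexI pa.
have [ps pt pa _] := sim_concat_le_ext y (xs u') (xt u') a c.
apply: (le_trans _ (@sim_le_ext_val y I u M a c)).
have pq : sim y (concat (xs u') (xt u')) (concat a c) <= q by rewrite lexI pa.
apply: (sim_trans (b := concat (xs u') (xt u'))) => //.
by apply: uu' => //; rewrite -tq.
Qed.

(** * Extensions by an empty tuple *)

Lemma ext_val_empty y M (I : Type) (u : extension Omega S L I) (a : I -> M)
    (c : seg (xdelta u) -> M) :
  (seg (xdelta u) -> False) ->
  ext_val y u a = sim y (concat (xs u) (xt u)) (concat a c).
Proof.
move=> J0; apply/le_anti; rewrite sim_le_ext_val andbT.
apply: ext_val_le => c'; suff -> : c' = c by [].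
by apply/funext => j; case: (J0 j).
Qed.

(** With [J] empty, [I + J] is a renaming of [I], and [sim_comp_le] applies. *)
Lemma sim_concat_empty y M N (I J : Type) (a : I -> M) (b : I -> N)
    (c : J -> M) (c' : J -> N) :
  (J -> False) -> sim y a b <= sim y (concat a c) (concat b c').
Proof.
move=> J0; pose h (k : I + J) : I :=
  match k with inl i => i | inr j => False_rect I (J0 j) end.
have hK : cancel h inl by case=> // j; case: (J0 j).
have -> : concat a c = a \o h by apply/funext => -[|j] //; case: (J0 j).
have -> : concat b c' = b \o h by apply/funext => -[|j] //; case: (J0 j).
exact: sim_comp_le hK _.
Qed.

(** * Similarity up to the extent as equality of F *)

Theorem sim_F x : sim_decides_F x.
Proof.
elim/(well_founded_ind (@wo_wf W)): x => x IH M N I a b ab; split.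
  move=> le_ab; apply/F_eqP.
  have /simP[_ H1 H2] := le_ab.
  have psi_eq (psi : atomic S I) : ainterp psi a = ainterp psi b.
    have /le_biimp := H1 psi.
    by rewrite -{1}ab !(meet_idPr (ainterp_le_ext _ _)).
  have u_eq y u : y < x -> ext_val y u a = ext_val y u b.
    by move=> /(H2 _ u)/le_biimp; rewrite -{1}ab !(meet_idPr (leIl _ _)).
  split; first exact/eq_Iat.
  move=> y delta yx; apply/funext => G; apply/funext => v; apply/propext.
  have V_eq (K : pSh Omega S) (s : I -> K) (t : seg delta -> K) :
      ext_tuple t <= Order.meet (ext_tuple a) (ext_tuple s) ->
      Fval y a s t = Fval y b s t.
    move=> ts; have ts' := ts; rewrite ab in ts'; have IHy := IH y yx.
    have [[j]|J0] := pselect (inhabited (seg delta)).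
      by rewrite !Fval_ext_val //; exact: u_eq.
    have {}J0 : seg delta -> False by move=> j; exact: J0 (inhabits j).
    rewrite !FvalE //; congr Sup; apply/seteqP.
    (* As [seg delta] is empty, each side is the only term of its [ext_val]. *)
    have e_eq (c : seg delta -> M) (c' : seg delta -> N) :
        sim y (concat s t) (concat a c) = sim y (concat s t) (concat b c').
      have := u_eq y (Extension s t) yx.
      by rewrite (@ext_val_empty _ _ _ (Extension s t) a c J0)
        (@ext_val_empty _ _ _ (Extension s t) b c' J0).
    split=> p [c [-> ct H]].
      exists (fun j => False_rect N (J0 j)).
      by rewrite -(e_eq c) !ext_tuple_empty // in ct H *.
    exists (fun j => False_rect M (J0 j)).
    by rewrite (e_eq _ c) !ext_tuple_empty // in ct H *.
  split=> -[K [s [t [ts -> ->]]]]; exists K, s, t; split=> //.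
  - by rewrite -ab.
  - exact: V_eq.
  - by rewrite ab.
  - by rewrite V_eq ?ab.
move=> Fab; apply/simP; split=> //.
  by have /F_eqP[/eq_Iat psi_eq _] := Fab => psi; rewrite psi_eq; apply/le_biimp.
move=> y u yx; apply/le_biimp; congr Order.meet.
suff le_u M' N' (a' : I -> M') (b' : I -> N') :
    ext_tuple a' = ext_tuple b' -> F L x a' = F L x b' ->
    ext_val y u a' <= ext_val y u b'.
  by apply/le_anti; rewrite !le_u.
move=> {M N a b Fab} {}ab Fab; have IHy := IH y yx.
have [[j]|J0] := pselect (inhabited (seg (xdelta u))).
  (* Cutting the extension down to [q], the same for both tuples, makes it an admissible argument of
     F. *)
  rewrite (ext_val_res _ _ a') (ext_val_res _ _ b') -ab.
  set q := Order.meet _ _; set t := res_tuple _ _.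
  have tq : ext_tuple t <= q.
    by rewrite (ext_tuple_res j) leIr.
  have tq' := tq; rewrite /q ab in tq'.
  rewrite -!(Fval_ext_val j) //.
  have /F_eqP[_ /(_ _ (xdelta u) yx) H] := Fab.
  have : Fgraph a' (F L y (concat (xs u) t)) (Fval y a' (xs u) t).
    by exists (xK u), (xs u), t.
  (* The graph at [b'] gives the value through other representatives [s'], [t']; [Fval_eq] returns
     to the original extension. *)
  rewrite H => -[K [s' [t' [ts' FE ->]]]].
  by rewrite (Fval_eq IHy tq' ts' FE).
have {}J0 : seg (xdelta u) -> False by move=> j; exact: J0 (inhabits j).
pose c' j := False_rect N' (J0 j).
apply: ext_val_le => c; rewrite (ext_val_empty y b' c' J0).
(* Transitivity passes through [concat a' c]: at stage [y], [a'] and [b'] are similar up to their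
   extent, which bounds every term of the join. *)
apply: sim_trans (le_refl _) _; apply: le_trans (sim_concat_empty _ _ _ _ _ J0).
have /IHy := ab; rewrite (le_F (ltW yx) Fab) => -[_ /(_ erefl)].
apply: le_trans; rewrite -ab; apply: le_trans (sim_le_ext _ _ _) _.
by rewrite !ext_concat leIxr ?leIl.
Qed.

End Similarity.

Theorem corollary12p3 (d : Order.disp_t) (Omega : cHeytingType d)
    (S : signature) (L : logic) (M N : pSh Omega S) (gamma : lam L)
    (a : seg gamma -> M) (b : seg gamma -> N) (hE : ext_tuple b = ext_tuple a)
    (W : wellOrder) (alpha : W) :
  interp (phi L alpha a) b = interp (phi L alpha b) b <->
  F L alpha a = F L alpha b.
Proof.
have [simF Fsim] := @sim_F _ _ _ L _ alpha _ _ _ a b (esym hE).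
(* The right-hand value is [ext_tuple b], which [sim L alpha a b] never exceeds, so their equality
   amounts to [ext_tuple b <= sim L alpha a b]. *)
rewrite -!/(sim L alpha _ _) simxx; split=> [ab|/Fsim bab].
  by apply: simF; rewrite ab.
by apply/le_anti; rewrite bab (le_trans (sim_le_ext _ _ _ _)) ?leIr.
Qed.
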